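(* Let $d\ge 0$ be an integer, let $m_1,\dots,m_r$ be positive integers, and let $\mathcal{L}_d(m_1,\dots,m_r)$ be the linear system of plane curves of degree $d$ in $\mathbb{P}^2_{\mathbb{C}}$ with multiplicity at least $m_i$ at $p_i$ for $i=1,\dots,r$, where $p_1,\dots,p_r$ are general points. Start from the empty triangular board of side $d+1$ and perform any sequence of moves of type A and type B such that each multiplicity $m_i$ (each index $i$) is used for a move of type A at most once. Then the dimension of $\mathcal{L}_d(m_1,\dots,m_r)$ is at most one less than the number of uncheckered boxes at the end of this sequence of moves. In particular, if all of the $\sum_{i=1}^r\binom{m_i+1}{2}$ checkers can be fit onto the board using only these two types of moves (each index used exactly once in a move of type A), then $\mathcal{L}_d(m_1,\dots,m_r)$ is non-special.
   Context: Dimensions of linear systems are projective (empty system: $-1$). The expected dimension is $e(\mathcal{L})=\max\{\binom{d+2}{2}-\sum_i\binom{m_i+1}{2}-1,-1\}$, and $\mathcal{L}$ is non-special if $\dim\mathcal{L}=e(\mathcal{L})$. The triangular board of side $d+1$ has $\binom{d+2}{2}$ boxes indexed by triples $(i,j,k)$ of nonnegative integers with $i+j+k=d$. A position is a subset of the boxes (those containing a checker; at most one checker per box). The three corners are $(d,0,0)$, $(0,d,0)$, $(0,0,d)$. The $m\times m$ corner triangle at $(d,0,0)$ is the set of boxes with $i\ge d-m+1$, and similarly with $j$ or $k$ in place of $i$ for the other two corners; it is available when $m\le d+1$ and then has $\binom{m+1}{2}$ boxes. Type A move: for a multiplicity $m_i$, choose a corner whose $m_i\times m_i$ corner triangle contains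 no checkers, and place a checker in each of its $\binom{m_i+1}{2}$ boxes. Type B move (one of six slides): choose one of the three coordinates to be held constant, so that the board is partitioned into lines parallel to one side of the triangle, and choose one of the two directions along these lines; then in every such line push all checkers as far as possible in the chosen direction, without overlapping (a line containing $c$ checkers ends with exactly the $c$ extreme boxes at that end occupied). *)

(* Defs.v *)
From HB Require Import structures.
From mathcomp Require Import all_boot all_order all_algebra.
From mathcomp Require Import complex reals mpoly.

Set Implicit Arguments.
Unset Strict Implicit.
Unset Printing Implicit Defensive.

Import Order.TTheory GRing.Theory Num.Theory.
Local Open Scope ring_scope.

(* A point of the projective plane over K is given by a nonzero vector        *)
(* p : 'rV[K]_3 of homogeneous coordinates; a configuration of r points is a  *)
(* matrix P : 'M[K]_(r, 3) all of whose rows are nonzero.                     *)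

Section LinearSystems.
Variable K : fieldType.

(* Index of the first nonzero coordinate of p, i.e., of the first standard    *)
(* affine chart containing p.                                                 *)
Definition chart (p : 'rV[K]_3) : 'I_3 :=
  odflt ord0 [pick k | p 0 k != 0].

(* Local equation at p of the curve F = 0: dehomogenize with respect to the   *)
(* coordinate k = chart p, then translate p to the origin. The variable 'X_k  *)
(* does not occur in the result, which is thus a polynomial in the two affine *)
(* coordinates at p.                                                          *)
Definition local_eq (p : 'rV[K]_3) (F : {mpoly K[3]}) : {mpoly K[3]} :=
  let k := chart p in
  F \mPo [tuple if i == k then 1 else (p 0 i / p 0 k)%:MP + 'X_i | i < 3].

(* The multiplicity at p is the smallest degree of a monomial occurring in    *)
(* the local equation (so that F = 0 satisfies this for all m).               *)
Definition mult_ge (m : nat) (p : 'rV[K]_3) (F : {mpoly K[3]}) : Prop :=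
  forall a : 'X_{1..3}, (mdeg a < m)%N -> (local_eq p F)@_a = 0.

Definition local_coef d (p : 'rV[K]_3) (a : 'X_{1..3}) (F : dhomog 3 K d) :
  K^o := (local_eq p F)@_a.

Fact local_coef_is_linear d p a : linear (@local_coef d p a).
Proof. by move=> c F G; rewrite /local_coef /local_eq !linearP. Qed.

HB.instance Definition _ d p a :=
  GRing.isLinear.Build K (dhomog 3 K d) K^o _ (@local_coef d p a)
    (@local_coef_is_linear d p a).

(* The vector space of forms of degree d with multiplicity at least m i at    *)
(* the i-th row of P (see linear_systemP).                                    *)
Definition linear_system d r (m : 'I_r -> nat) (P : 'M[K]_(r, 3)) :
    {vspace dhomog 3 K d} :=
  (\bigcap_(i < r) \bigcap_(a : 'X_{1..3 < m i})
     lker (linfun (@local_coef d (row i P) a)))%VS.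

Lemma linear_systemP d r (m : 'I_r -> nat) P (F : dhomog 3 K d) :
  F \in linear_system d m P <-> forall i, mult_ge (m i) (row i P) F.
Proof.
rewrite memvE; split=> [/subv_bigcapP sFm i a lt_am | Fm].
  have /subv_bigcapP/(_ (BMultinom lt_am) isT) := sFm i isT.
  by rewrite -memvE memv_ker lfunE => /eqP.
apply/subv_bigcapP=> i _; apply/subv_bigcapP=> a _.
by rewrite -memvE memv_ker lfunE; apply/eqP/Fm/bmdeg.
Qed.

(* Dimension of the projective space of curves P(V), equal to -1 if V = 0.    *)
Definition proj_dim (V : vectType K) (U : {vspace V}) : int := (\dim U)%:Z - 1.

(* In the ring of polynomials in the entries of an r x 3 matrix,              *)
(* multihomogeneous of degree e i in the entries of each row i.               *)
Definition multihomog r (e : 'I_r -> nat) (G : {mpoly K[r * 3]}) : Prop :=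
  forall a, a \in msupp G ->
  forall i : 'I_r, (\sum_(c < 3) a (mxvec_index i c))%N = e i.

(* S holds for r general points of the plane, i.e., on a nonempty Zariski     *)
(* open subset of the r-fold product of the plane with itself; every such     *)
(* subset contains the nonvanishing locus of a nonzero multihomogeneous G.    *)
Definition for_general_points r (S : 'M[K]_(r, 3) -> Prop) : Prop :=
  exists (e : 'I_r -> nat) (G : {mpoly K[r * 3]}),
    [/\ multihomog e G, G != 0 &
        forall P : 'M[K]_(r, 3), (forall i, row i P != 0) ->
          G.@[fun j => mxvec P 0 j] != 0 -> S P].

End LinearSystems.

Definition expected_dim d r (m : 'I_r -> nat) : int :=
  Num.max ('C(d + 2, 2)%:Z - (\sum_(i < r) 'C(m i + 1, 2)%:Z) - 1) (-1).

Definition non_special (K : fieldType) d r (m : 'I_r -> nat) : Prop :=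
  @for_general_points K r
    (fun P => proj_dim (linear_system d m P) = expected_dim d m).

(* The boxes of the triangular board of side d + 1.                           *)
Definition box (d : nat) : finType :=
  {b : {ffun 'I_3 -> 'I_d.+1} | (\sum_(c < 3) b c == d)%N}.

Definition box_coord d (b : box d) (c : 'I_3) : nat := val b c.

Definition corner_triangle d (c : 'I_3) (m : nat) : {set box d} :=
  [set b : box d | d + 1 <= box_coord b c + m]%N.

(* The slide with the coordinate c held constant, in the direction in which   *)
(* the coordinate t != c increases: a box is occupied afterwards iff the      *)
(* number of boxes beyond it on its line is less than the number of checkers  *)
(* on that line.                                                              *)
Definition slide d (c t : 'I_3) (S : {set box d}) : {set box d} :=
  let line b := [set b' : box d | box_coord b' c == box_coord b c] in
  [set b : box d |
    #|[set b' in line b | box_coord b t < box_coord b' t]|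
      < #|line b :&: S|]%N.

(* reachable m U S: the position S can be obtained from the empty board by a  *)
(* sequence of moves whose type A moves use exactly the indices in U, each    *)
(* of them once.                                                              *)
Inductive reachable d r (m : 'I_r -> nat) :
    {set 'I_r} -> {set box d} -> Prop :=
| reach_empty : reachable m set0 set0
| reach_typeA U S (i : 'I_r) (c : 'I_3) :
    reachable m U S -> i \notin U -> (m i <= d + 1)%N ->
    [disjoint corner_triangle d c (m i) & S] ->
    reachable m (i |: U) (corner_triangle d c (m i) :|: S)
| reach_typeB U S (c t : 'I_3) :
    reachable m U S -> t != c -> reachable m U (slide c t S).

(* Main.v *)
Require Import Defs.
From HB Require Import structures.
From mathcomp Require Import all_boot all_order all_algebra.
From mathcomp Require Import complex reals mpoly.
From mathcomp Require Import ring zify.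

(** The multiplicity conditions at a configuration P of points span a space of
    functionals on the forms of degree d; in coordinates indexed by the monomials,
    that is, by the boxes, a position S stands for the coordinate subspace spanned
    by the boxes of S. The moves are degenerations: whenever the position S is
    reachable with the indices in U, the coordinate subspace of S is a limit of
    subspaces of the conditions at the points indexed by U. The invariant
    [approximable] says so with epsilons: for every eps > 0 some configuration
    imposes conditions w b, for b in S, whose coefficients are eps-close to those
    of the coordinate functionals b.

    A move of type A keeps the invariant because a point of multiplicity m placed
    at a corner of the coordinate triangle imposes exactly the vanishing of the
    coefficients in the corner triangle of size m ([approximable_typeA]).

    For a move of type B, all points are moved by the shear x_t -> x_t + x * x_s,
    with t the direction of the slide and s the third coordinate. The shear acts
    on each line of the board, and there the coefficients of the sheared
    coordinate functionals are binomial coefficients times powers of x. When x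
    grows, combinations of those indexed by the n boxes of S on the line tend to
    the coordinate functionals of the n extreme boxes, provided that the minor of
    the Pascal matrix on these rows and the last n columns is invertible
    ([binomial_interpolation]). By duality this is the fact that a nonzero
    polynomial with at most N terms is not divisible by (X + 1)^N
    ([sparse_poly_eq0]). Hence [approximable_typeB].

    Once eps * #|S| < 1, no nonzero form of the linear system is supported on S
    ([approximable_no_form]). This amounts to the nonvanishing of a maximal minor
    of the matrix of conditions, a multihomogeneous polynomial in the coordinates
    of the points, so it holds for general points ([generic_no_form_on]). Then the
    coefficients outside S determine the forms of the system, which gives the upper
    bound. Non-speciality follows from the lower bound given by the number of
    conditions ([dim_linear_system_ge]) and from the count of the checkers
    ([reachable_card]).

    The translation between multiplicities and linear algebra goes through the
    chart-free criterion [mult_ge_translate]: a form F has multiplicity at least m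
    at p when F (p + X) has no term of degree less than m, p being any vector of
    homogeneous coordinates. *)

Set Implicit Arguments.
Unset Strict Implicit.
Unset Printing Implicit Defensive.

Import Order.TTheory GRing.Theory Num.Theory.
Local Open Scope ring_scope.

(** * Order of vanishing at the origin *)

Section Vanishing.
Variables (R : comNzRingType) (n : nat).
Implicit Types F G : {mpoly R[n]}.

Definition vanish m F := forall a : 'X_{1..n}, (mdeg a < m)%N -> F@_a = 0.

Lemma vanishW m m' F : (m' <= m)%N -> vanish m F -> vanish m' F.
Proof. by move=> le_m vF a lt_a; apply/vF/(leq_trans lt_a). Qed.

Lemma vanishZ m c F : vanish m F -> vanish m (c *: F).
Proof. by move=> vF a lt_a; rewrite mcoeffZ vF ?mulr0. Qed.

Lemma vanish_sum m (I : Type) (s : seq I) (P : pred I) (F : I -> {mpoly R[n]}) :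
  (forall i, P i -> vanish m (F i)) -> vanish m (\sum_(i <- s | P i) F i).
Proof.
by move=> vF a lt_a; rewrite raddf_sum big1 // => i Pi; apply: vF.
Qed.

Lemma vanishM m1 m2 F G : vanish m1 F -> vanish m2 G -> vanish (m1 + m2) (F * G).
Proof.
move=> vF vG a lt_a; rewrite mcoeffM big1 // => -[k1 k2] /= /eqP def_a.
have [lt1|ge1] := ltnP (mdeg k1) m1; first by rewrite vF ?mul0r.
rewrite vG ?mulr0 // -(ltn_add2l m1); apply: leq_ltn_trans lt_a.
by rewrite [leqRHS](congr1 mdeg def_a) mdegD leq_add2r.
Qed.

Lemma vanishX m F k : vanish m F -> vanish (m * k) (F ^+ k).
Proof.
move=> vF; elim: k => [|k IHk]; first by rewrite muln0.
by rewrite exprS mulnS; apply: vanishM.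
Qed.

Lemma vanish_prod (I : Type) (s : seq I) (P : pred I) (e : I -> nat)
    (F : I -> {mpoly R[n]}) :
  (forall i, P i -> vanish (e i) (F i)) ->
  vanish (\sum_(i <- s | P i) e i) (\prod_(i <- s | P i) F i).
Proof.
move=> vF; elim/big_ind2: _ => // [e1 F1 e2 F2 vF1 vF2]; exact: vanishM.
Qed.

End Vanishing.

Section Substitution.
Variables (R : comNzRingType) (n k : nat).

Lemma vanish_comp m (F : {mpoly R[n]}) (l : n.-tuple {mpoly R[k]}) :
  (forall i, vanish 1 (tnth l i)) -> vanish m F -> vanish m (F \mPo l).
Proof.
move=> vl vF; rewrite comp_mpolyE; apply: vanish_sum => a _.
have [lt_a|ge_a] := ltnP (mdeg a) m.
  by rewrite vF // scale0r => b _; rewrite mcoeff0.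
apply/vanishZ/(vanishW ge_a); rewrite mdegE; apply: vanish_prod => i _.
by have := vanishX (k := a i) (vl i); rewrite mul1n.
Qed.

Lemma comp_comp_mpoly p (F : {mpoly R[n]}) (l : n.-tuple {mpoly R[k]})
    (l' : k.-tuple {mpoly R[p]}) :
  (F \mPo l) \mPo l' = F \mPo [tuple tnth l i \mPo l' | i < n].
Proof.
rewrite [F \mPo l]comp_mpolyE [RHS]comp_mpolyE raddf_sum; apply: eq_bigr => a _.
rewrite /= comp_mpolyZ rmorph_prod /=; congr (_ *: _); apply: eq_bigr => i _.
by rewrite rmorphXn tnth_mktuple.
Qed.

Lemma comp_mpoly_scale d (F : {mpoly R[n]}) (l : n.-tuple {mpoly R[k]}) c :
  F \is d.-homog -> F \mPo [tuple c *: tnth l i | i < n] = c ^+ d *: (F \mPo l).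
Proof.
move=> /dhomogP hF; rewrite comp_mpolyE [in RHS]comp_mpolyE scaler_sumr.
rewrite big_seq [RHS]big_seq; apply: eq_bigr => a /hF/= def_d.
rewrite scalerA mulrC -scalerA; congr (_ *: _).
rewrite -def_d mdegE -prodrXr -scaler_prod; apply: eq_bigr => i _.
by rewrite tnth_mktuple exprZn.
Qed.

Lemma homog_comp d (F : {mpoly R[n]}) (l : n.-tuple {mpoly R[k]}) :
  F \is d.-homog -> (forall i, tnth l i \is 1.-homog) -> F \mPo l \is d.-homog.
Proof.
move=> /dhomogP hF hl; rewrite comp_mpolyE big_seq; apply: rpred_sum => a /hF/= def_d.
apply: rpredZ; rewrite -def_d mdegE.
elim/big_ind2: _ => [|e f e' f' |i _]; [exact: dhomog1 | exact: dhomogM|].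
by have := dhomogMn (a i) (hl i); rewrite mul1n.
Qed.

Lemma vanish_homog (F : {mpoly R[n]}) d : F \is d.-homog -> vanish d F.
Proof.
move=> hF a lt_a; apply: (dhomog_nemf_coeff hF).
by rewrite neq_ltn lt_a.
Qed.

End Substitution.

(** * Intrinsic description of the multiplicity at a point *)

Section Multiplicity.
Variable K : fieldType.
Implicit Types (F : {mpoly K[3]}) (p : 'rV[K]_3) (k : 'I_3).

(** The full Taylor expansion at a vector of homogeneous coordinates; unlike the local
    equation it involves no chart, hence is compatible with linear substitutions. *)
Definition translate p F := F \mPo [tuple (p 0 i)%:MP + 'X_i | i < 3].

(** Substitution by a unipotent linear map that sends the k-th coordinate point to q, for
    q with k-th coordinate 1. *)
Definition move_to_corner k (q : 'I_3 -> K) F :=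
  F \mPo [tuple if i == k then 'X_k else q i *: 'X_k + 'X_i | i < 3].

Definition dehom k F := F \mPo [tuple if i == k then 1 else 'X_i | i < 3].

Definition mnm_erase k (b : 'X_{1..3}) : 'X_{1..3} :=
  [multinom if i == k then 0%N else b i | i < 3].

Lemma mdeg_erase k b : (mdeg (mnm_erase k b) + b k = mdeg b)%N.
Proof.
rewrite !mdegE (bigD1 k) //= [in RHS](bigD1 k) //= mnmE eqxx add0n addnC.
by congr addn; apply: eq_bigr => i /negPf ne_ik; rewrite mnmE ne_ik.
Qed.

Lemma homogX1 i : ('X_i : {mpoly K[3]}) \is 1.-homog.
Proof. by rewrite dhomogX /= mdeg1. Qed.

Lemma dehomE k F :
  dehom k F = \sum_(b <- msupp F) F@_b *: 'X_[mnm_erase k b].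
Proof.
rewrite /dehom comp_mpolyE; apply: eq_bigr => b _; congr (_ *: _).
rewrite mpolyXE_id; apply: eq_bigr => i _; rewrite tnth_mktuple mnmE.
by case: (i == k); rewrite ?expr1n.
Qed.

(** On monomials of a fixed degree, erasing the exponent of X_k is injective: dehomogenizing
    a form does not mix its coefficients. *)
Lemma dehom_coef d F k b : F \is d.-homog -> mdeg b = d ->
  (dehom k F)@_(mnm_erase k b) = F@_b.
Proof.
move=> /dhomogP hF deg_b; rewrite dehomE [in RHS](mpolyE F).
rewrite !raddf_sum /= big_seq [RHS]big_seq; apply: eq_bigr => a /hF/= deg_a.
rewrite !mcoeffZ !mcoeffX; congr (_ * _%:R); congr nat_of_bool.
apply/eqP/eqP => [eq_er|-> //]; apply/mnmP=> i.
have [->|ne_ik] := eqVneq i k.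
  apply: (@addnI (mdeg (mnm_erase k a))).
  by rewrite mdeg_erase eq_er mdeg_erase deg_b.
by move/mnmP/(_ i): eq_er; rewrite !mnmE (negPf ne_ik).
Qed.

Lemma dehom_coef0 k F (a : 'X_{1..3}) : a k != 0%N -> (dehom k F)@_a = 0.
Proof.
move=> ak_neq0; rewrite dehomE raddf_sum big1 // => b _ /=.
rewrite mcoeffZ mcoeffX; case: eqP => [eq_a|_]; last by rewrite mulr0.
by rewrite -eq_a mnmE eqxx in ak_neq0.
Qed.

Lemma local_eq_dehom p F :
  local_eq p F = dehom (chart p) (move_to_corner (chart p) (fun i => p 0 i / p 0 (chart p)) F).
Proof.
rewrite /local_eq /dehom /move_to_corner comp_comp_mpoly; congr (_ \mPo _).
apply: eq_mktuple => i; rewrite tnth_mktuple; case: ifP => [_|ne_ik].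
  by rewrite comp_mpolyXU -tnth_nth tnth_mktuple eqxx.
rewrite linearD linearZ /= !comp_mpolyXU -!tnth_nth !tnth_mktuple eqxx ne_ik.
by rewrite alg_mpolyC.
Qed.

Lemma move_to_corner_homog d k q F : F \is d.-homog -> move_to_corner k q F \is d.-homog.
Proof.
move=> hF; apply: homog_comp hF _ => i; rewrite tnth_mktuple.
by case: ifP => _; rewrite ?rpredD ?rpredZ ?homogX1.
Qed.

(** After the point has been moved to a corner, multiplicity at least m is the vanishing of
    the coefficients in a corner triangle of the board. *)
Lemma mult_ge_move_to_corner d m p F : F \is d.-homog -> mult_ge m p F ->
  forall b : 'X_{1..3}, (d < b (chart p) + m)%N ->
    (move_to_corner (chart p) (fun i => p 0 i / p 0 (chart p)) F)@_b = 0.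
Proof.
move=> hF mF b lt_b; set k := chart p in lt_b *.
have hB := move_to_corner_homog k (fun i => p 0 i / p 0 k) hF.
have [deg_b|] := eqVneq (mdeg b) d; last exact: dhomog_nemf_coeff.
rewrite -(dehom_coef k hB deg_b) -local_eq_dehom mF //.
by rewrite -(ltn_add2l (b k)) addnC mdeg_erase deg_b.
Qed.

Lemma chart_neq0 p : p != 0 -> p 0 (chart p) != 0.
Proof.
move=> p_neq0; rewrite /chart; case: pickP => //= p0.
case/eqP: p_neq0; apply/rowP => i; rewrite mxE.
by move/negbFE/eqP: (p0 i).
Qed.

Lemma vanish1X i : vanish 1 ('X_i : {mpoly K[3]}).
Proof. by apply: vanish_homog (homogX1 i). Qed.

Lemma vanish1D F G : vanish 1 F -> vanish 1 G -> vanish 1 (F + G).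
Proof. by move=> vF vG a lt_a; rewrite mcoeffD vF ?vG ?addr0. Qed.

(** The local equation is recovered from the Taylor expansion by setting X_k = 0 and rescaling.
    Conversely, F (p + X) is the form moved to the corner, in which
    X_k is replaced by p_k + X_k and X_i by X_i - q_i X_k for i != k; a monomial b with
    d - b_k >= m then contributes d - b_k factors without constant term. *)
Lemma mult_ge_translate d m p F : p != 0 -> F \is d.-homog ->
  mult_ge m p F <-> vanish m (translate p F).
Proof.
move=> p_neq0 hF; have := chart_neq0 p_neq0; set k := chart p => pk_neq0.
pose q i := p 0 i / p 0 k.
split=> [mF | vF a lt_a]; last first.
  suff ->: local_eq p F = (p 0 k) ^- d *:
      (translate p F \mPo [tuple if i == k then 0 else p 0 k *: 'X_i | i < 3]).
    rewrite mcoeffZ (@vanish_comp _ _ _ m) ?mulr0 // => i.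
    rewrite tnth_mktuple; case: ifP => _; last exact/vanishZ/vanish1X.
    by move=> b _; rewrite mcoeff0.
  rewrite /translate /local_eq -/k comp_comp_mpoly.
  rewrite -[F \mPo _](scalerK (expf_neq0 d pk_neq0)); congr (_ *: _).
  rewrite -(comp_mpoly_scale _ _ hF); congr (_ \mPo _); apply: eq_mktuple => i.
  rewrite !tnth_mktuple linearD /= comp_mpolyC comp_mpolyXU -tnth_nth.
  rewrite tnth_mktuple; case: eqP => [->|_].
    by rewrite addr0 -alg_mpolyC.
  by rewrite scalerDr -!mul_mpolyC -mpolyCM mulrC divfK.
have ->: translate p F = move_to_corner k q F \mPo
    [tuple if i == k then (p 0 k)%:MP + 'X_k else 'X_i - q i *: 'X_k | i < 3].
  rewrite /translate /move_to_corner comp_comp_mpoly; congr (_ \mPo _).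
  apply: eq_mktuple => i; rewrite tnth_mktuple; case: ifP => [/eqP->|ne_ik].
    by rewrite comp_mpolyXU -tnth_nth tnth_mktuple eqxx.
  rewrite linearD linearZ /= !comp_mpolyXU -!tnth_nth !tnth_mktuple eqxx ne_ik.
  rewrite scalerDr -mul_mpolyC -mpolyCM /q divfK // -addrA; congr (_ + _).
  by rewrite addrC subrK.
rewrite comp_mpolyE big_seq; apply: vanish_sum => b Hb.
have [lt_b|ge_b] := ltnP d (b k + m).
  by rewrite (mult_ge_move_to_corner hF mF lt_b) scale0r => a _; rewrite mcoeff0.
apply: vanishZ; rewrite (bigD1 k) //=.
have deg_b: mdeg b = d.
  by have /dhomogP/(_ b Hb) := move_to_corner_homog k q hF.
have le_m: (m <= 0 + \sum_(i < 3 | i != k) b i)%N.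
  rewrite -deg_b mdegE (bigD1 k) //= leq_add2l in ge_b.
  by rewrite add0n.
apply: (vanishW le_m); apply: vanishM => //.
apply: vanish_prod => i /negPf ne_ik; rewrite tnth_mktuple ne_ik.
have v1: vanish 1 ('X_i - q i *: 'X_k : {mpoly K[3]}).
  by rewrite -scaleNr; apply/vanish1D; [|apply/vanishZ]; apply: vanish1X.
by have := vanishX (k := b i) v1; rewrite mul1n.
Qed.

Definition linsubst (A : 'M[K]_3) F :=
  F \mPo [tuple \sum_j A i j *: 'X_j | i < 3].

Lemma linsubst_homog d A F : F \is d.-homog -> linsubst A F \is d.-homog.
Proof.
move=> hF; apply: homog_comp hF _ => i; rewrite tnth_mktuple.
by apply: rpred_sum => j _; rewrite rpredZ ?homogX1.
Qed.

(** Multiplicities do not depend on the coordinates: (F o A)(p + X) = F (A p + A X), and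
    substituting linear forms does not lower the order of vanishing. *)
Lemma mult_ge_linsubst d m p A F : A \in unitmx -> p != 0 -> F \is d.-homog ->
  mult_ge m (p *m A^T) F -> mult_ge m p (linsubst A F).
Proof.
move=> uA p_neq0 hF.
have Ap_neq0: p *m A^T != 0.
  apply: contraNneq p_neq0 => pA0.
  by rewrite -[p](@mulmxK _ _ _ A^T) ?unitmx_tr // pA0 mul0mx.
move/(mult_ge_translate _ Ap_neq0 hF) => vF.
apply/(mult_ge_translate _ p_neq0 (linsubst_homog A hF)).
have ->: translate p (linsubst A F) = linsubst A (translate (p *m A^T) F).
  rewrite /translate /linsubst.
  rewrite (comp_comp_mpoly F) [RHS](comp_comp_mpoly F).
  apply: (congr1 (fun l => comp_mpoly l F)).
  apply: eq_mktuple => i; rewrite !tnth_mktuple linearD /= comp_mpolyC.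
  rewrite comp_mpolyXU -tnth_nth tnth_mktuple mxE raddf_sum /=.
  under eq_bigr do rewrite comp_mpolyZ comp_mpolyXU -tnth_nth tnth_mktuple scalerDr.
  rewrite big_split /=; congr (_ + _).
  rewrite raddf_sum; apply: eq_bigr => j _.
  by rewrite -mul_mpolyC -mpolyCM mxE mulrC.
apply: vanish_comp vF => i; rewrite tnth_mktuple.
by apply: vanish_sum => j _; apply/vanishZ/vanish1X.
Qed.

(** This is the effect of a move of type A. *)
Lemma mult_ge_corner d m k F : F \is d.-homog -> mult_ge m (delta_mx 0 k) F ->
  forall b : 'X_{1..3}, (d < b k + m)%N -> F@_b = 0.
Proof.
move=> hF mF b.
have cE: chart (delta_mx 0 k : 'rV[K]_3) = k.
  have: (delta_mx 0 k : 'rV[K]_3) != 0.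
    by apply/eqP => /matrixP/(_ 0 k)/eqP; rewrite !mxE !eqxx oner_eq0.
  by move/chart_neq0; rewrite mxE eqxx; case: (chart _ =P k); rewrite ?eqxx.
move: (mult_ge_move_to_corner hF mF) => /(_ b); rewrite cE => /[apply].
rewrite /move_to_corner; set t := mktuple _.
suff ->: t = [tuple 'X_i | i < 3] by rewrite comp_mpoly_id.
apply: eq_mktuple => i; rewrite !mxE eqxx /=; case: eqP => [->|_] //.
by rewrite mul0r scale0r add0r.
Qed.

End Multiplicity.

(** * Boxes, lines and slides *)

Section Boxes.
Local Open Scope nat_scope.
Variable d : nat.
Implicit Types (b : box d) (c t : 'I_3) (S : {set box d}).

Definition box_mnm b : 'X_{1..3} := [multinom box_coord b c | c < 3].

Lemma mdeg_box b : mdeg (box_mnm b) = d.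
Proof.
rewrite mdegE -[RHS](eqP (valP b)).
by apply: eq_bigr => c _; rewrite mnmE.
Qed.

Lemma box_mnm_inj : injective box_mnm.
Proof.
move=> b b' /mnmP eq_b; apply/val_inj/ffunP => c; apply/val_inj.
by have := eq_b c; rewrite !mnmE.
Qed.

Lemma box_of_mnm (a : 'X_{1..3}) : mdeg a = d -> exists b, box_mnm b = a.
Proof.
move=> deg_a.
have le_a c : a c < d.+1 by rewrite ltnS -deg_a mdegE (bigD1 c) //= leq_addr.
pose f : {ffun 'I_3 -> 'I_d.+1} := [ffun c => Ordinal (le_a c)].
have fP : \sum_(c < 3) f c == d.
  by apply/eqP; rewrite -[RHS]deg_a mdegE; apply: eq_bigr => c _; rewrite ffunE.
exists (exist _ f fP); apply/mnmP => c.
by rewrite mnmE /box_coord /= ffunE.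
Qed.

Lemma card_box : #|box d| = 'C(d + 2, 2).
Proof.
rewrite -(@bin_sub _ 2) ?leq_addl // addnK -size_basis.
rewrite cardE -(size_map box_mnm); apply/perm_size/uniq_perm.
- by rewrite map_inj_uniq ?enum_uniq //; apply: box_mnm_inj.
- exact: uniq_basis.
move=> a; rewrite -basis_cover; apply/mapP/eqP => [[b _ ->]|/box_of_mnm[b <-]].
  exact: mdeg_box.
by exists b; rewrite ?mem_enum.
Qed.

Lemma third_coord c t : t != c ->
  exists s, [/\ s != c, s != t & forall i, i != c -> i != t -> i = s].
Proof.
move=> ne_tc; have /cards1P[s def_s] : #|~: [set c; t]| == 1.
  by rewrite cardsCs setCK card_ord cards2 (eq_sym c) ne_tc.
have: s \in ~: [set c; t] by rewrite def_s set11.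
rewrite !inE => /norP[sc st]; exists s; split=> // i ic it.
by apply/set1P; rewrite -def_s !inE negb_or ic.
Qed.

Lemma sum_third (f : 'I_3 -> nat) c t s : t != c -> s != c -> s != t ->
  (forall i, i != c -> i != t -> i = s) -> \sum_(i < 3) f i = f c + (f t + f s).
Proof.
move=> tc sc st all_s; rewrite (bigD1 c) //= (bigD1 t) //= (bigD1 s) ?sc //=.
rewrite big1 ?addn0 // => i /andP[/andP[ic it]].
by rewrite (all_s i) ?eqxx.
Qed.

Lemma box_coord_sum b c t : t != c -> box_coord b c + box_coord b t <= d.
Proof.
move=> ne_tc; have [s [sc st all_s]] := third_coord ne_tc.
rewrite -[leqRHS](eqP (valP b)) (sum_third _ ne_tc sc st all_s) addnA.
exact: leq_addr.
Qed.

Lemma box_eq b b' c t : t != c -> box_coord b c = box_coord b' c ->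
  box_coord b t = box_coord b' t -> b = b'.
Proof.
move=> ne_tc eq_c eq_t; have [s [sc st all_s]] := third_coord ne_tc.
have: \sum_(i < 3) box_coord b i = \sum_(i < 3) box_coord b' i.
  exact: etrans (eqP (valP b)) (esym (eqP (valP b'))).
rewrite !(sum_third _ ne_tc sc st all_s) eq_c eq_t => /addnI/addnI eq_s.
apply: box_mnm_inj; apply/mnmP => i; rewrite !mnmE.
have [->//|ic] := eqVneq i c; have [->//|it] := eqVneq i t.
by rewrite (all_s i).
Qed.

Lemma box_exists c t x y : t != c -> x + y <= d ->
  exists b, box_coord b c = x /\ box_coord b t = y.
Proof.
move=> ne_tc le_xy; have [s [sc st all_s]] := third_coord ne_tc.
pose a := [multinom if i == c then x else if i == t then y else d - (x + y) | i < 3].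
have deg_a: mdeg a = d.
  rewrite mdegE (sum_third _ ne_tc sc st all_s) !mnmE !eqxx.
  by rewrite (negPf ne_tc) (negPf sc) (negPf st) addnA subnKC.
have [b def_a] := box_of_mnm deg_a; exists b.
have bE i : box_coord b i = a i by rewrite -def_a mnmE.
by rewrite !bE !mnmE !eqxx (negPf ne_tc).
Qed.

(** The coordinate t numbers the boxes of a line from 0 to d - x. *)
Lemma card_line c t x (P : pred nat) : t != c -> x <= d ->
  #|[set b : box d | box_coord b c == x & P (box_coord b t)]|
    = #|[set k : 'I_(d - x).+1 | P k]|.
Proof.
move=> ne_tc le_x; pose tau (b : box d) : 'I_(d - x).+1 := inord (box_coord b t).
have tauE b : box_coord b c = x -> tau b = box_coord b t :> nat.
  by move=> bx; rewrite inordK // ltnS leq_subRL // -bx box_coord_sum.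
rewrite -(@card_in_imset _ _ tau) => [|b b'].
  apply: eq_card => k; rewrite inE; apply/imsetP/idP => [[b]|Pk].
    by rewrite inE => /andP[/eqP bx Pb] ->; rewrite tauE.
  have le_k: x + k <= d by rewrite -leq_subRL // -ltnS.
  have [b [bc bt]] := box_exists ne_tc le_k; exists b.
    by rewrite inE bc bt eqxx.
  by apply: val_inj; rewrite /= tauE.
rewrite !inE => /andP[/eqP bx _] /andP[/eqP b'x _] eq_tau.
by apply: (box_eq ne_tc); [rewrite bx | rewrite -(tauE b bx) eq_tau tauE].
Qed.

Lemma card_ord_lt N s : s <= N -> #|[set k : 'I_N | k < s]| = s.
Proof.
move=> le_s; rewrite -sum1_card.
under eq_bigl do rewrite inE.
by rewrite (big_ord_narrow le_s) sum1_card card_ord.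
Qed.

(** In the coordinate t, the number of boxes beyond b on its line is d - b_c - b_t. *)
Lemma in_slide c t b S : t != c ->
  (b \in slide c t S) =
  (d - box_coord b c - box_coord b t
     < #|[set b' in S | box_coord b' c == box_coord b c]|).
Proof.
move=> ne_tc; rewrite inE; set x := box_coord b c; set y := box_coord b t.
have le_xy: x + y <= d := box_coord_sum b ne_tc.
have le_x: x <= d := leq_trans (leq_addr y x) le_xy.
congr (_ < _); last by apply: eq_card => b'; rewrite !inE andbC.
rewrite (eq_card (B := [set b' : box d | box_coord b' c == x & y < box_coord b' t])).
  rewrite card_line // cardsCs card_ord.
  rewrite (eq_card (B := [set k : 'I_(d - x).+1 | k < y.+1])) => [|k].
    by rewrite card_ord_lt ?subSS // ltnS leq_subRL.
  by rewrite !inE -leqNgt.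
by move=> b'; rewrite !inE.
Qed.

Lemma card_slide c t S : t != c -> #|slide c t S| = #|S|.
Proof.
move=> ne_tc; have coordP (b : box d) : box_coord b c < d.+1 by rewrite /box_coord.
have cardE (T : {set box d}) :
    #|T| = \sum_(x < d.+1) #|[set b in T | box_coord b c == x]|.
  rewrite -sum1_card (partition_big (fun b => Ordinal (coordP b)) xpredT) //=.
  apply: eq_bigr => x _; rewrite -sum1_card; apply: eq_bigl => b.
  by rewrite !inE.
rewrite !cardE; apply: eq_bigr => x _.
have le_x: x <= d by rewrite -ltnS.
pose n := d - x; set s := #|[set b in S | box_coord b c == x]|.
have le_s: s <= n.+1.
  rewrite -[n.+1]card_ord -cardsT.
  have := card_line xpredT ne_tc le_x; rewrite -/n => eqT.
  have ->: [set: 'I_n.+1] = [set k : 'I_n.+1 | true] by [].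
  rewrite -eqT subset_leq_card //; apply/subsetP => b.
  by rewrite !inE andbT => /andP[].
transitivity #|[set b : box d | box_coord b c == x & n - box_coord b t < s]|.
  apply: eq_card => b; rewrite inE in_slide // inE andbC.
  by case: eqP => //= ->.
rewrite (card_line (fun y => n - y < s)) // -(card_imset _ (@rev_ord_inj _)).
rewrite -[RHS](card_ord_lt le_s); apply: eq_card => k; rewrite inE.
apply/imsetP/idP => [[j]|lt_k].
  by rewrite inE => lt_j -> /=; rewrite subSS.
by exists (rev_ord k); rewrite ?rev_ordK // inE /= subSS subKn // -ltnS.
Qed.

End Boxes.

Section Counting.
Local Open Scope nat_scope.

(** The corner triangle is a translate of the board of side m. *)
Lemma card_corner_triangle d c m : 0 < m -> m <= d + 1 ->
  'C(m + 1, 2) <= #|corner_triangle d c m|.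
Proof.
move=> m_gt0 le_m.
have sum_m: m.-1 + (d + 1 - m) = d.
  by apply: succn_inj; rewrite -addSn prednK // subnKC // addn1.
have /fin_all_exists[h hP] (b : box m.-1) :
    exists b' : box d, box_mnm b' = (box_mnm b + U_(c) *+ (d + 1 - m))%MM.
  by apply: box_of_mnm; rewrite mdegD mdegMn mdeg_box mdeg1 mul1n sum_m.
have h_inj: injective h.
  move=> b b' /(congr1 (@box_mnm d)); rewrite !hP => /addIm.
  exact: box_mnm_inj.
have -> : 'C(m + 1, 2) = #|box m.-1| by rewrite card_box -{1}(prednK m_gt0) addSnnS.
rewrite -(card_image h_inj); apply/subset_leq_card/subsetP => _ /codomP[b ->].
have /mnmP/(_ c) := hP b; rewrite mnmDE mulmnE mnm1E eqxx mul1n !mnmE inE => ->.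
by rewrite -addnA subnK // leq_addl.
Qed.

(** A monomial of degree less than m in the two affine coordinates corresponds to a box of the
    board of side m: the k-th exponent completes its degree to m - 1. *)
Lemma card_local_conditions m (k : 'I_3) : 0 < m ->
  #|[pred a : 'X_{1..3 < m} | (a : 'X_{1..3}) k == 0]| <= 'C(m + 1, 2).
Proof.
move=> m_gt0.
have -> : 'C(m + 1, 2) = #|box m.-1| by rewrite card_box -{1}(prednK m_gt0) addSnnS.
have /fin_all_exists[h hP] (a : 'X_{1..3 < m}) :
    exists b : box m.-1, box_mnm b = (a + U_(k) *+ (m.-1 - mdeg a))%MM.
  apply: box_of_mnm; rewrite mdegD mdegMn mdeg1 mul1n subnKC //.
  by rewrite -ltnS prednK // bmdeg.
rewrite -(@card_in_imset _ _ h) ?max_card // => a a'.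
rewrite !inE => /eqP ak /eqP a'k /(congr1 (@box_mnm _)); rewrite !hP.
move/mnmP => eq_a; apply/val_inj/mnmP => i /=.
have := eq_a i; rewrite !mnmDE !mulmnE !mnm1E.
have [->|ne_ik] := eqVneq i k; first by rewrite ak a'k.
by rewrite !mul0n !addn0.
Qed.

End Counting.

(** * Minors of the Pascal matrix *)

Section Binomials.
Variable K : numFieldType.

(** The exponents of q are in s. If 0 is in s, the derivative of q loses one possible
    exponent and one order of vanishing at a; otherwise q can be divided by X. In both cases the
    size decreases. *)
Lemma sparse_poly_eq0 (a : K) (q : {poly K}) (s : seq nat) : a != 0 ->
  (forall i, q`_i != 0 -> i \in s) -> ('X - a%:P) ^+ size s %| q -> q = 0.
Proof.
move=> a_neq0; have [n] := ubnP (size q).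
elim: n q s => // n IHn q s; rewrite ltnS => le_q q_s dv_q.
have [//|q_neq0] := eqVneq q 0.
have [s0|s'0] := boolP (0%N \in s).
  have lt_q': (size q^`() < n)%N by exact: leq_trans (lt_size_deriv _) le_q.
  have s_gt0: (0 < size s)%N by case: (s) s0.
  have sz_s: size (map predn (rem 0%N s)) = (size s).-1 by rewrite size_map size_rem.
  have q'0: q^`() = 0.
    apply: (IHn _ (map predn (rem 0%N s))) => // [i|].
      rewrite coef_deriv => qi; apply/mapP; exists i.+1 => //.
      apply: rem_mem => //.
      by apply: q_s; apply: contraNneq qi => ->; rewrite mul0rn.
    rewrite sz_s; case/dvdpP: dv_q => r ->.
    rewrite derivM deriv_exp derivB derivX derivC subr0 mul1r.
    apply: dvdp_add; first by rewrite dvdp_mull // dvdp_exp2l // leq_pred.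
    by rewrite dvdp_mull // -mulr_natl dvdp_mull.
  have sz_q: (size q <= 1)%N.
    apply/leq_sizeP => -[//|i] _; have /polyP/(_ i) := q'0.
    by rewrite coef_deriv coef0 => /eqP; rewrite mulrn_eq0 => /eqP.
  have : root q a.
    rewrite -dvdp_XsubCl; apply: dvdp_trans dv_q.
    by rewrite -(prednK s_gt0) exprS dvdp_mulr.
  by rewrite (size1_polyC sz_q) rootC => /eqP->.
have q0: q`_0 = 0 by apply: contraNeq s'0; apply: q_s.
have : root q 0 by rewrite rootE horner_coef0 q0.
case/factor_theorem => q1; rewrite subr0 => def_q.
rewrite def_q in q_neq0 *.
suff ->: q1 = 0 by rewrite mul0r.
have q1_neq0: q1 != 0 by apply: contraNneq q_neq0 => ->; rewrite mul0r.
apply: (IHn _ (map predn s)) => [|i q1i|].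
- by move: le_q; rewrite def_q size_mulX.
- apply/mapP; exists i.+1 => //; apply: q_s.
  by rewrite def_q coefMX.
- rewrite size_map; move: dv_q; rewrite def_q Gauss_dvdpl //.
  apply: coprimep_expl; rewrite -[X in coprimep _ X]subr0 -polyC0.
  by rewrite coprimep_XsubC root_XsubC eq_sym.
Qed.

Lemma coef_addX1_exp k i : (('X + 1 : {poly K}) ^+ k)`_i = 'C(k, i)%:R.
Proof.
have ->: ('X + 1 : {poly K}) ^+ k = \poly_(j < k.+1) 'C(k, j)%:R.
  rewrite addrC exprDn poly_def; apply: eq_bigr => j _.
  by rewrite expr1n mul1r scaler_nat.
by rewrite coef_poly ltnS; case: leqP => // lt_k; rewrite bin_small.
Qed.

(** The rows l in J and the last #|J| columns k of the Pascal matrix form an invertible minor.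
    A linear relation v between the columns yields the polynomial q, sum of the v_k (X + 1)^k,
    which is divisible by (X + 1)^N and has at most N terms, for N = n + 1 - #|J|. *)
Lemma binomial_interpolation n (J : {set 'I_n.+1}) k0 :
    (k0 <= n)%N -> (n - k0 < #|J|)%N ->
  exists a : 'I_n.+1 -> K, forall k, (k <= n)%N -> (n - k < #|J|)%N ->
    \sum_(l in J) a l * 'C(k, l)%:R = (k == k0)%:R.
Proof.
move=> le_k0 lt_k0.
have le_J: (#|J| <= n.+1)%N by have := max_card (mem J); rewrite card_ord.
pose B : 'M[K]_#|J| := \matrix_(i < #|J|, j < #|J|) 'C(n - j, @enum_val _ (mem J) i)%:R.
have uB: B \in unitmx.
  rewrite -unitmx_tr -row_free_unit -kermx_eq0; apply/rowV0P => v.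
  move=> /sub_kermxP vB.
  pose q : {poly K} := \sum_(j < #|J|) v 0 j *: ('X + 1) ^+ (n - j).
  have q0: q = 0.
    apply: (@sparse_poly_eq0 (-1) _ [seq val l | l <- enum (~: J)]).
    - by rewrite oppr_eq0 oner_eq0.
    - move=> i qi; have qiE: q`_i = \sum_(j < #|J|) v 0 j * 'C(n - j, i)%:R.
        rewrite coef_sum; apply: eq_bigr => j _; rewrite coefZ; congr (_ * _).
        by rewrite coef_addX1_exp.
      have lt_i: (i < n.+1)%N.
        rewrite ltnS leqNgt; apply: contra qi => lt_i; rewrite qiE big1 // => j _.
        by rewrite bin_small ?mulr0 // (leq_ltn_trans (leq_subr _ _)).
      apply/mapP; exists (Ordinal lt_i) => //; rewrite mem_enum inE.
      apply: contra qi => Ji; rewrite qiE.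
      have /rowP/(_ (enum_rank_in Ji (Ordinal lt_i))) := vB.
      rewrite !mxE => vB0; apply/eqP; rewrite -[RHS]vB0; apply: eq_bigr => j _.
      by rewrite !mxE enum_rankK_in.
    - rewrite polyCN opprK polyC1 size_map -cardE cardsCs setCK card_ord.
      rewrite /q; elim/big_ind: _ => [|f g|j _]; [exact: dvdp0 | exact: dvdp_add |].
      rewrite -mul_polyC dvdp_mull // dvdp_exp2l //.
      by rewrite -(subSS j n) leq_sub2l.
  apply/rowP => j; rewrite mxE.
  have := congr1 (fun p => (p \Po ('X - 1))`_(n - j)) q0.
  rewrite comp_poly0 coef0 => <-; rewrite raddf_sum coef_sum (bigD1 j) //=.
  have XE k : (('X + 1) ^+ k \Po ('X - 1)) = 'X^k :> {poly K}.
    by rewrite rmorphXn /= rmorphD /= comp_polyX rmorph1 subrK.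
  have le_n (i : 'I_#|J|) : (i <= n)%N by rewrite -ltnS (leq_trans (ltn_ord i)).
  rewrite linearZ /= XE coefZ coefXn eqxx mulr1 big1 ?addr0 // => i ne_ij.
  rewrite linearZ /= XE coefZ coefXn; case: eqP => [e|_]; last by rewrite mulr0.
  case/eqP: ne_ij; apply: val_inj.
  by rewrite /= -(subKn (le_n i)) -[RHS](subKn (le_n j)) e.
pose y := delta_mx (0 : 'I_1) (Ordinal lt_k0) *m invmx B.
have [l0 Jl0]: exists l0, l0 \in J.
  by apply/set0Pn; rewrite -card_gt0 (leq_ltn_trans (leq0n _) lt_k0).
exists (fun l => y 0 (enum_rank_in Jl0 l)) => k le_k lt_k.
have /rowP/(_ (Ordinal lt_k)) : y *m B = delta_mx 0 (Ordinal lt_k0) by rewrite mulmxKV.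
rewrite !mxE /= -val_eqE /= => yB; rewrite big_enum_val /=.
transitivity ((n - k == n - k0)%N%:R : K).
  rewrite -yB; apply: eq_bigr => i _; rewrite enum_valK_in !mxE /=.
  by rewrite subKn.
congr (nat_of_bool _)%:R; apply/eqP/eqP => [e|->] //.
by rewrite -(subKn le_k) e subKn.
Qed.

End Binomials.

(** * Forms, conditions and shears *)

Section Moves.
Variables (K : numFieldType) (d r : nat) (m : 'I_r -> nat).
Implicit Types (P : 'M[K]_(r, 3)) (U : {set 'I_r}) (S : {set box d}).
Implicit Types (w : box d -> K) (b l : box d) (c t s : 'I_3).

Lemma box_expansion (F : {mpoly K[3]}) : F \is d.-homog ->
  F = \sum_(b : box d) F@_(box_mnm b) *: 'X_[box_mnm b].
Proof.
move=> hF; apply/mpolyP => a; rewrite raddf_sum /=.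
under eq_bigr do rewrite mcoeffZ mcoeffX.
have [/box_of_mnm[b <-]|ne_d] := eqVneq (mdeg a) d.
  rewrite (bigD1 b) //= eqxx mulr1 big1 ?addr0 // => b' ne_b'.
  by rewrite (inj_eq (@box_mnm_inj d)) (negPf ne_b') mulr0.
rewrite (dhomog_nemf_coeff hF ne_d) big1 // => b _.
case: eqP => [eq_a|_]; last by rewrite mulr0.
by rewrite -eq_a mdeg_box eqxx in ne_d.
Qed.

(** The functional with coordinates w belongs to the span of the conditions with indices in U,
    expressed by duality: it kills every form that satisfies these conditions. *)
Definition annihilates U P w := forall F : dhomog 3 K d,
  (forall i, i \in U -> mult_ge (m i) (row i P) F) ->
  \sum_b w b * F@_(box_mnm b) = 0.

Definition shear t s (x : K) : 'M[K]_3 := 1%:M + x *: delta_mx t s.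

(** The coefficient of the monomial l in the sheared monomial b, see [shear_coefP]. *)
Definition shear_coef c t (x : K) b l : K :=
  (box_coord b c == box_coord l c)%:R *
  ('C(box_coord b t, box_coord l t)%:R * x ^+ (box_coord b t - box_coord l t)).

Lemma shear_unit t s x : s != t -> shear t s x \in unitmx.
Proof.
move=> ne_st; apply: (proj1 (@mulmx1_unit _ _ _ (shear t s (- x)) _)).
rewrite /shear mulmxDl mul1mx mulmxDr mulmx1 -scalemxAl -scalemxAr.
by rewrite mul_delta_mx_0 // !scaler0 addr0 scaleNr addrNK.
Qed.

(** Only (X_t + x X_s)^(b_t) is expanded; among monomials of the same degree with the same
    exponent of X_c, the exponent of X_t determines the monomial. *)
Lemma shear_coefP c t s x b l : t != c -> s != c -> s != t ->
    (forall i, i != c -> i != t -> i = s) ->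
  (linsubst (shear t s x) 'X_[box_mnm b])@_(box_mnm l) = shear_coef c t x b l.
Proof.
move=> tc sc st all_s.
have lE i : \sum_j shear t s x i j *: 'X_j =
    'X_i + ((i == t)%:R * x) *: 'X_s :> {mpoly K[3]}.
  under eq_bigr do rewrite !mxE scalerDl.
  rewrite big_split /=; congr (_ + _).
    rewrite (bigD1 i) //= eqxx scale1r big1 ?addr0 // => j ne_ji.
    by rewrite eq_sym (negPf ne_ji) scale0r.
  rewrite (bigD1 s) //= eqxx andbT mulrC big1 ?addr0 // => j ne_js.
  by rewrite (negPf ne_js) andbF mulr0 scale0r.
rewrite /linsubst comp_mpolyX (bigD1 c) //= (bigD1 t) //= (bigD1 s) ?sc //=.
rewrite big1 ?mulr1 => [|i /andP[/andP[ic it]]]; last by rewrite (all_s i) ?eqxx.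
rewrite !tnth_mktuple !lE eqxx (negPf st) eq_sym (negPf tc) !mul0r !scale0r !addr0 mul1r.
have bE i : box_mnm b i = box_coord b i by rewrite mnmE.
rewrite !bE addrC exprDn mulr_suml mulr_sumr raddf_sum /=.
pose y j : 'X_{1..3} :=
  (U_(c) *+ box_coord b c + (U_(t) *+ j + U_(s) *+ (box_coord b t - j + box_coord b s)))%MM.
under eq_bigr => j _.
  rewrite exprZn -scalerAl scalerMnl -!scalerAl -scalerAr mcoeffZ.
  have -> : 'X_c ^+ box_coord b c * ('X_s ^+ (box_coord b t - j) * 'X_t ^+ j *
      'X_s ^+ box_coord b s) = 'X_[y j] :> {mpoly K[3]}.
    rewrite /y !mpolyXD -!mpolyXn exprD; congr (_ * _).
    by rewrite mulrAC mulrC mulrA.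
  rewrite mcoeffX.
  over.
pose j0 := box_coord l t; set n := box_coord b t.
rewrite /shear_coef -/n -/j0.
have yE j : (j <= n)%N -> (y j == box_mnm l) = (box_coord b c == box_coord l c) && (j == j0).
  move=> le_j; have y_c : y j c = box_coord b c.
    rewrite !mnmDE !mulmnE !mnm1E eqxx (negPf tc) (negPf sc) mul1n !mul0n.
    by rewrite !addn0.
  have y_t : y j t = j.
    rewrite !mnmDE !mulmnE !mnm1E eqxx (negPf st) eq_sym (negPf tc) mul1n !mul0n.
    by rewrite addn0.
  have deg_y : mdeg (y j) = d.
    rewrite !mdegD !mdegMn !mdeg1 !mul1n [(j + _)%N]addnA subnKC //.
    rewrite -[RHS](mdeg_box b) mdegE.
    by rewrite (sum_third _ tc sc st all_s) !mnmE.
  have [b' def_b'] := box_of_mnm deg_y.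
  have b'E i : box_coord b' i = y j i by rewrite -def_b' mnmE.
  rewrite -def_b' (inj_eq (@box_mnm_inj d)).
  apply/eqP/andP => [eq_l|[/eqP eq_c /eqP eq_t]].
    by rewrite -y_c -{2}y_t -!b'E eq_l !eqxx.
  by apply: (box_eq tc); rewrite b'E ?y_c ?y_t.
under eq_bigr => j _ do rewrite yE -1?ltnS //.
have [le_j0|lt_j0] := leqP j0 n; last first.
  rewrite bin_small // mul0r mulr0 big1 // => j _.
  have [eq_j|_] := eqVneq (val j) j0; last by rewrite andbF mulr0.
  by move: (ltn_ord j); rewrite eq_j ltnS leqNgt lt_j0.
rewrite (bigD1 (Ordinal (le_j0 : j0 < n.+1)%N)) //= eqxx andbT big1 => [|j ne_j].
  by rewrite addr0 mulrC; congr (_ * _); rewrite mulr_natl.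
by rewrite -(inj_eq val_inj) /= in ne_j; rewrite (negPf ne_j) andbF mulr0.
Qed.

(** If F satisfies the conditions at the sheared points, then its image by the shear satisfies
    those at the original points, so w kills it; this is a relation on the coefficients of F. *)
Lemma annihilates_shear U P w c t s (x : K) : t != c -> s != c -> s != t ->
    (forall i, i != c -> i != t -> i = s) ->
    (forall i, row i P != 0) -> annihilates U P w ->
  annihilates U (P *m (shear t s x)^T)
    (fun b => \sum_l w l * shear_coef c t x b l).
Proof.
move=> tc sc st all_s P_neq0 wP F mF.
have hF : (F : {mpoly K[3]}) \is d.-homog := dhomog_is_dhomog F.
pose G := DHomog (linsubst_homog (shear t s x) hF).
have mG i : i \in U -> mult_ge (m i) (row i P) G.
  move=> Ui; apply: (mult_ge_linsubst _ (P_neq0 i) hF); first exact: shear_unit.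
  by rewrite -row_mul; apply: mF.
rewrite -[RHS](wP G mG).
under eq_bigr do rewrite mulr_suml.
rewrite exchange_big; apply: eq_bigr => l _ /=.
have -> : (linsubst (shear t s x) F)@_(box_mnm l) =
    \sum_b F@_(box_mnm b) * shear_coef c t x b l.
  rewrite {1}(box_expansion hF).
  rewrite (big_morph (linsubst _) (comp_mpolyD _) (comp_mpoly0 _)) raddf_sum /=.
  apply: eq_bigr => b _; rewrite [linsubst _ _]comp_mpolyZ mcoeffZ.
  by congr (_ * _); apply: shear_coefP.
rewrite mulr_sumr; apply: eq_bigr => b _.
by rewrite -mulrA [X in _ * X]mulrC.
Qed.

(** [binomial_interpolation] on each line: alpha b' combines the rows indexed by the checkers
    of the line of b' so as to obtain the delta function at b' on the boxes occupied after
    the slide. *)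
Lemma slide_coefficients c t S : t != c ->
  exists alpha : box d -> box d -> K, forall b b',
    b \in slide c t S -> b' \in slide c t S -> box_coord b c = box_coord b' c ->
  \sum_(l in S | box_coord l c == box_coord b' c)
     alpha b' l * 'C(box_coord b t, box_coord l t)%:R = (b == b')%:R.
Proof.
move=> ne_tc.
suff /fin_all_exists[alpha alphaP] b' : exists a : box d -> K,
    b' \in slide c t S -> forall b, b \in slide c t S ->
    box_coord b c = box_coord b' c ->
  \sum_(l in S | box_coord l c == box_coord b' c)
     a l * 'C(box_coord b t, box_coord l t)%:R = (b == b')%:R.
  by exists alpha => b b' *; apply: alphaP.
have [b'S|_] := boolP (b' \in slide c t S); last by exists (fun _ => 0).
set x := box_coord b' c; pose n := (d - x)%N.
pose tau b : 'I_n.+1 := inord (box_coord b t).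
have le_t b : box_coord b c = x -> (box_coord b t <= n)%N.
  move=> bx; have le_d := box_coord_sum b ne_tc.
  by rewrite leq_subRL -bx ?le_d // (leq_trans (leq_addr _ _) le_d).
have tauE b : box_coord b c = x -> tau b = box_coord b t :> nat.
  by move=> bx; rewrite inordK // ltnS le_t.
pose L := [set l in S | box_coord l c == x].
have tau_inj : {in L &, injective tau}.
  move=> l l'; rewrite !inE => /andP[_ /eqP lx] /andP[_ /eqP l'x] eq_tau.
  by apply: (box_eq ne_tc); [rewrite lx | rewrite -(tauE l lx) eq_tau tauE].
have cardJ : #|tau @: L| = #|L| := card_in_imset tau_inj.
have lt_b b : b \in slide c t S -> box_coord b c = x ->
    (n - box_coord b t < #|tau @: L|)%N.
  by rewrite in_slide // cardJ => + bx; rewrite bx.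
have [a aP] := binomial_interpolation K (le_t b' erefl) (lt_b b' b'S erefl).
exists (fun l => a (tau l)) => _ b bS bx.
have := aP _ (le_t b bx) (lt_b b bS bx).
rewrite big_imset //= => aPb; transitivity ((box_coord b t == box_coord b' t)%:R : K).
  rewrite -aPb; apply: eq_big => l; first by rewrite !inE.
  by case/andP=> _ /eqP lx; rewrite tauE.
congr (nat_of_bool _)%:R; apply/eqP/eqP => [eq_t|-> //].
exact: box_eq ne_tc bx eq_t.
Qed.

(** The coordinate subspace of S is a limit of subspaces of the span of the conditions with
    indices in U. *)
Definition approximable U S := forall eps : K, 0 < eps ->
  exists P (w : box d -> box d -> K),
    [/\ forall i, row i P != 0,
        forall b, b \in S -> annihilates U P (w b) &
        forall b l, b \in S -> `|w b l - (b == l)%:R| <= eps].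

Lemma approximable0 : approximable set0 set0.
Proof.
move=> eps _; exists (const_mx 1), (fun _ _ => 0); split=> [i|b|b l]; rewrite ?in_set0 //.
by apply/eqP => /matrixP/(_ 0 0)/eqP; rewrite !mxE oner_eq0.
Qed.

(** Putting the i-th point at the corner makes the coordinate functionals of the corner
    triangle exact conditions, and leaves the conditions with indices in U unchanged. *)
Lemma approximable_typeA U S i c : approximable U S -> i \notin U ->
  approximable (i |: U) (corner_triangle d c (m i) :|: S).
Proof.
move=> US_approx U'i eps eps_gt0; have [P [w [P_neq0 wP w_eps]]] := US_approx _ eps_gt0.
pose P' := \matrix_(j, k) (if j == i then (k == c)%:R else P j k) : 'M[K]_(r, 3).
have P'i : row i P' = delta_mx 0 c by apply/rowP => k; rewrite !mxE eqxx.
have P'E j : j != i -> row j P' = row j P.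
  by move/negPf=> ne_ji; apply/rowP => k; rewrite !mxE ne_ji.
have dc : (delta_mx 0 c : 'rV[K]_3) != 0.
  by apply/eqP => /matrixP/(_ 0 c)/eqP; rewrite !mxE !eqxx oner_eq0.
exists P', (fun b => if b \in corner_triangle d c (m i) then fun l => (b == l)%:R else w b).
split=> [j|b|b l].
- by have [->|ne_ji] := eqVneq j i; rewrite ?P'i ?P'E.
- case: ifP => [Tb _|T'b] /=; last first.
    rewrite inE T'b /= => Sb F mF; apply: wP => // j Uj.
    rewrite -P'E; first by apply: mF; rewrite setU1r.
    by apply: contraNneq U'i => <-.
  move=> F mF; rewrite (bigD1 b) //= eqxx mul1r big1 ?addr0 => [|l ne_lb].
    have mFi : mult_ge (m i) (delta_mx 0 c) (F : {mpoly K[3]}).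
      by rewrite -P'i; apply: mF; rewrite setU11.
    apply: (mult_ge_corner (dhomog_is_dhomog F) mFi).
    by move: Tb; rewrite inE addn1 mnmE.
  by rewrite eq_sym (negPf ne_lb) mul0r.
case: ifP => [_ _|T'b]; first by rewrite subrr normr0 ltW.
by rewrite inE T'b; apply: w_eps.
Qed.

Lemma annihilates_comb U P (z : box d -> K) (v : box d -> box d -> K) :
  (forall l, z l != 0 -> annihilates U P (v l)) ->
  annihilates U P (fun b => \sum_l z l * v l b).
Proof.
move=> vP F mF; under eq_bigr do rewrite mulr_suml.
rewrite exchange_big big1 //= => l _.
under eq_bigr do rewrite -mulrA.
by rewrite -mulr_sumr; have [->|/vP->//] := eqVneq (z l) 0; rewrite ?mul0r ?mulr0.
Qed.

Lemma term_le_sum (I : finType) (f : I -> K) i : (forall j, 0 <= f j) -> f i <= \sum_j f j.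
Proof. by move=> f_ge0; rewrite (bigD1 i) //= lerDl sumr_ge0. Qed.

Section LimitCombination.
Variables (S : {set box d}) (c t : 'I_3) (alpha : box d -> box d -> K) (x : K).

Definition line_sum b' b := \sum_(l in S | box_coord l c == box_coord b' c)
     alpha b' l * 'C(box_coord b t, box_coord l t)%:R.

(** The powers of x undo the scaling by the diagonal torus that relates the shear of parameter x
    to the one of parameter 1. *)
Definition limit_coef b' l : K :=
  if (l \in S) && (box_coord l c == box_coord b' c)
  then alpha b' l * x ^+ box_coord l t / x ^+ box_coord b' t else 0.

(** The value at b' is normalized to line_sum b' b', and the other boxes b of the line are scaled
    by x^(b_t - b'_t): those before b' in the direction of the slide tend to 0 when x grows. *)
Lemma limit_coefE b' b : x != 0 ->
  \sum_l limit_coef b' l * shear_coef c t x b l =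
  (box_coord b c == box_coord b' c)%:R *
    (x ^+ box_coord b t / x ^+ box_coord b' t) * line_sum b' b.
Proof.
move=> x_neq0; rewrite /limit_coef [in RHS]/line_sum mulr_sumr [RHS]big_mkcond /=.
apply: eq_bigr => l _; case: ifP => [/andP[_ /eqP lc]|_]; last by rewrite mul0r.
rewrite /shear_coef lc.
have [le_t|lt_t] := leqP (box_coord l t) (box_coord b t); last first.
  by rewrite bin_small // mul0r !mulr0.
have -> : x ^+ box_coord b t = x ^+ box_coord l t * x ^+ (box_coord b t - box_coord l t).
  by rewrite -exprD subnKC.
by field; apply: expf_neq0.
Qed.

End LimitCombination.

(** First x is chosen so large that the combination of the sheared coordinate functionals is
    within eps / 2 of the limit; then, x being fixed, delta is chosen so small that replacing
    the coordinate functionals by delta-approximations adds an error of at most eps / 2. *)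
Lemma approximable_typeB U S c t : t != c ->
  approximable U S -> approximable U (slide c t S).
Proof.
move=> tc US_approx eps eps_gt0; have [s [sc st all_s]] := third_coord tc.
have [alpha alphaP] := slide_coefficients S tc.
pose q := line_sum S c t alpha.
pose Q : K := \sum_b' \sum_b `|q b' b|.
have q_le b' b : `|q b' b| <= Q.
  apply: le_trans (term_le_sum b' _) => [|j]; last exact: sumr_ge0.
  exact: (@term_le_sum _ (fun b => `|q b' b|)).
have Q_ge0 : 0 <= Q by do 2!apply: sumr_ge0 => ? _.
pose x := 1 + 2 * Q / eps.
have x_ge1 : 1 <= x by rewrite lerDl divr_ge0 ?mulr_ge0 // ltW.
have x_gt0 : 0 < x by apply: lt_le_trans x_ge1.
have x_neq0 : x != 0 by rewrite gt_eqF.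
have Qx : Q / x <= eps / 2.
  rewrite ler_pdivrMr //; have -> : eps / 2 * x = eps / 2 + Q.
    by rewrite /x; field; rewrite gt_eqF.
  by rewrite lerDr divr_ge0 // ltW.
pose z := limit_coef S c t alpha x.
pose M : K := \sum_(b' : box d) \sum_(b : box d) \sum_(l : box d) \sum_(l' : box d)
  `|z b' l * shear_coef c t x b l'|.
have M_ge0 : 0 <= M by do 4!apply: sumr_ge0 => ? _.
pose delta := eps / (2 * (1 + M)).
have M1_gt0 : 0 < 1 + M by rewrite ltr_wpDr.
have delta_gt0 : 0 < delta by rewrite divr_gt0 ?mulr_gt0.
have [P [w [P_neq0 wP w_delta]]] := US_approx _ delta_gt0.
exists (P *m (shear t s x)^T),
  (fun b' b => \sum_l z b' l * \sum_l' w l l' * shear_coef c t x b l').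
split=> [i|b' _|b' b b'S].
- apply: contraNneq (P_neq0 i); rewrite row_mul => PA0.
  by rewrite -[row i P](@mulmxK _ _ _ (shear t s x)^T) ?unitmx_tr ?shear_unit // PA0 mul0mx.
- apply: annihilates_comb => l; rewrite /z /limit_coef;
  case: ifP => [/andP[Sl _] _|]; last by rewrite eqxx.
  exact: (annihilates_shear tc sc st all_s P_neq0 (wP _ Sl)).
have -> : \sum_l z b' l * (\sum_l' w l l' * shear_coef c t x b l') =
    \sum_l z b' l * shear_coef c t x b l +
    \sum_l \sum_l' (w l l' - (l == l')%:R) * (z b' l * shear_coef c t x b l').
  rewrite -big_split /=; apply: eq_bigr => l _.
  have -> : z b' l * shear_coef c t x b l =
      \sum_l' (l == l')%:R * (z b' l * shear_coef c t x b l').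
    rewrite (bigD1 l) //= eqxx mul1r big1 ?addr0 // => l' ne_l'.
    by rewrite eq_sym (negPf ne_l') mul0r.
  rewrite mulr_sumr -big_split /=; apply: eq_bigr => l' _.
  by rewrite -mulrDl addrC subrK mulrCA.
rewrite addrAC [eps]splitr; apply: le_trans (ler_normD _ _) _; apply: lerD; last first.
  apply: (@le_trans _ _ (delta * M)); last first.
    have -> : delta * M = eps / 2 * (M / (1 + M)) by rewrite /delta; field; rewrite gt_eqF.
    by rewrite ler_piMr ?divr_ge0 ?(ltW eps_gt0) // ler_pdivrMr // mul1r lerDr.
  apply: (@le_trans _ _ (delta * \sum_l \sum_l' `|z b' l * shear_coef c t x b l'|)); last first.
    rewrite ler_pM2l //.
    apply: le_trans (term_le_sum b' _) => [|j]; last by do 3!apply: sumr_ge0 => ? _.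
    apply: (@term_le_sum _ (fun b => \sum_l \sum_l' `|z b' l * shear_coef c t x b l'|)) => j.
    by do 2!apply: sumr_ge0 => ? _.
  rewrite mulr_sumr; apply: le_trans (ler_norm_sum _ _ _) _; apply: ler_sum => l _.
  rewrite mulr_sumr; apply: le_trans (ler_norm_sum _ _ _) _; apply: ler_sum => l' _.
  rewrite normrM; have [Sl|S'l] := boolP (l \in S).
    by rewrite ler_wpM2r ?normr_ge0 // w_delta.
  by rewrite /z /limit_coef (negPf S'l) mul0r normr0 !mulr0.
rewrite limit_coefE // -/q.
have eps2 : 0 <= eps / 2 by rewrite divr_ge0 // ltW.
have [eq_c|ne_c] := eqVneq (box_coord b c) (box_coord b' c); last first.
  by have [eq_b|_] := eqVneq b' b; rewrite ?eq_b ?eqxx // in ne_c *; rewrite !mul0r subr0 normr0.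
rewrite /= mul1r; have [bS|bS'] := boolP (b \in slide c t S).
  rewrite [q b' b]alphaP // [b == b']eq_sym; have [->|_] := eqVneq b' b.
    by rewrite mulr1 divff ?expf_neq0 // subrr normr0.
  by rewrite mulr0 subr0 normr0.
have -> : b' == b = false by apply: contraNF bS' => /eqP<-.
rewrite subr0.
(* On the line of b', the unoccupied boxes precede the occupied ones. *)
have lt_t : (box_coord b t < box_coord b' t)%N.
  rewrite ltnNge; apply: contra bS' => le_t; move: b'S; rewrite !in_slide // eq_c.
  by apply: leq_ltn_trans; apply: leq_sub2l.
apply: le_trans Qx; rewrite normrM mulrC; apply: ler_pM => //.
rewrite -(subnK lt_t) exprD exprS.
set u := x ^+ box_coord b t; set v := x ^+ _.
have u_neq0 : u != 0 by apply: expf_neq0.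
have v_ge1 : 1 <= v by apply: exprn_ege1.
have v_gt0 : 0 < v by apply: lt_le_trans v_ge1.
have -> : u / (v * (x * u)) = (v * x)^-1.
  by field; rewrite u_neq0 x_neq0 gt_eqF.
rewrite ger0_norm ?invr_ge0 ?mulr_ge0 ?(ltW v_gt0) ?(ltW x_gt0) //.
by rewrite lef_pV2 ?posrE ?mulr_gt0 // ler_peMl // ltW.
Qed.

Theorem reachable_approximable U S : reachable m U S -> approximable U S.
Proof.
elim=> [|{}U {}S i c _ US_approx U'i _ _|{}U {}S c t _ US_approx ne_tc].
- exact: approximable0.
- exact: approximable_typeA.
- exact: approximable_typeB.
Qed.

End Moves.

(** * Back to exact statements *)

Section Generic.
Variables (K : numFieldType) (d r : nat) (m : 'I_r -> nat).
Implicit Types (P : 'M[K]_(r, 3)) (U : {set 'I_r}) (S : {set box d}).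

Lemma translate_coef (p : 'rV[K]_3) (a b : 'X_{1..3}) :
  (translate p 'X_[b])@_a = \prod_(c < 3) ('C(b c, a c)%:R * p 0 c ^+ (b c - a c)).
Proof.
(* A common range for the exponents of the three factors, which also contains those of a. *)
pose N := (mdeg a + mdeg b).+1.
have expE c : tnth [tuple (p 0 i)%:MP + 'X_i | i < 3] c ^+ b c =
    \sum_(j < N) ('C(b c, j)%:R * p 0 c ^+ (b c - j)) *: 'X_c ^+ j
    :> {mpoly K[3]}.
  have le_N : ((b c).+1 <= N)%N.
    by rewrite /N ltnS mdegE mdegE (bigD1 c) //= [X in (_ + X)%N](bigD1 c) //= addnCA leq_addr.
  rewrite tnth_mktuple exprDn.
  rewrite (big_ord_widen N (fun j => (p 0 c)%:MP ^+ (b c - j) * 'X_c ^+ j *+ 'C(b c, j))) //.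
  rewrite big_mkcond; apply: eq_bigr => j _; rewrite ltnS; case: leqP => [_|lt_j].
    by rewrite -rmorphXn mul_mpolyC scalerMnl mulr_natl.
  by rewrite bin_small // mul0r scale0r.
rewrite /translate comp_mpolyX; under eq_bigr do rewrite expE.
rewrite bigA_distr_bigA /= raddf_sum /=.
have lt_a c : (a c < N)%N.
  by rewrite /N ltnS mdegE (bigD1 c) //= -addnA leq_addr.
pose f0 : {ffun 'I_3 -> 'I_N} := [ffun c => Ordinal (lt_a c)].
have termE (f : {ffun 'I_3 -> 'I_N}) :
    (\prod_c (('C(b c, f c)%:R * p 0 c ^+ (b c - f c)) *: 'X_c ^+ f c))@_a =
    (\prod_c ('C(b c, f c)%:R * p 0 c ^+ (b c - f c))) * (f == f0)%:R.
  rewrite scaler_prod mcoeffZ; congr (_ * _).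
  have -> : \prod_c 'X_c ^+ f c = 'X_[ [multinom val (f c) | c < 3] ] :> {mpoly K[3]}.
    by rewrite mpolyXE_id; apply: eq_bigr => c _; rewrite mnmE.
  rewrite mcoeffX; congr (nat_of_bool _)%:R.
  apply/eqP/eqP => [/mnmP eq_a|->]; last by apply/mnmP => c; rewrite mnmE ffunE.
  by apply/ffunP => c; apply: val_inj; rewrite ffunE /= -eq_a mnmE.
rewrite (bigD1 f0) //= termE eqxx mulr1 [X in _ + X]big1 ?addr0 => [|f /negPf ne_f].
  by apply: eq_bigr => c _; rewrite ffunE.
by rewrite termE ne_f mulr0.
Qed.

(** The square matrix of the w b on S is a perturbation of the identity: a form supported on S
    that it kills has l1-norm s with s <= #|S| * eps * s, hence s = 0. *)
Lemma approximable_no_form U S : approximable K m U S ->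
  exists P, (forall i, row i P != 0) /\
    forall F : dhomog 3 K d, (forall i, mult_ge (m i) (row i P) F) ->
      (forall b, b \notin S -> F@_(box_mnm b) = 0) ->
      forall b : box d, F@_(box_mnm b) = 0.
Proof.
(* With this value, 1 - #|S| * eps = eps > 0. *)
pose eps : K := (#|S|.+1)%:R^-1.
case/(_ eps) => [|P [w [P_neq0 wP w_eps]]]; first by rewrite invr_gt0 ltr0n.
exists P; split=> // F mF F0 b.
have [Sb|/F0//] := boolP (b \in S).
pose s := \sum_(l in S) `|F@_(box_mnm l)|.
have s_ge0 : 0 <= s by apply: sumr_ge0.
have F_le l : l \in S -> `|F@_(box_mnm l)| <= eps * s.
  move=> Sl; have wF := wP l Sl F (fun i _ => mF i).
  have -> : F@_(box_mnm l) = - \sum_(l' in S) (w l l' - (l == l')%:R) * F@_(box_mnm l').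
    have wFS : \sum_(l' in S) w l l' * F@_(box_mnm l') = 0.
      rewrite -[RHS]wF big_mkcond; apply: eq_bigr => l' _ /=.
      by case: ifPn => // /F0->; rewrite mulr0.
    under eq_bigr do rewrite mulrBl.
    rewrite sumrB wFS sub0r opprK (bigD1 l) //= eqxx mul1r big1 ?addr0 // => l' /andP[_ ne_l'].
    by rewrite eq_sym (negPf ne_l') mul0r.
  rewrite normrN mulr_sumr; apply: le_trans (ler_norm_sum _ _ _) _; apply: ler_sum => l' _.
  by rewrite normrM ler_wpM2r ?w_eps.
have s_le : s <= #|S|%:R * (eps * s).
  by rewrite mulr_natl -sumr_const; apply: ler_sum.
have s0 : s = 0.
  apply/eqP; rewrite eq_le s_ge0 andbT.
  move: s_le; rewrite mulrA -subr_ge0 -{2}[s]mul1r -mulrBl.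
  have -> : #|S|%:R * eps - 1 = - eps.
    rewrite /eps -natr1; field.
    by rewrite natr1 pnatr_eq0.
  by rewrite mulNr oppr_ge0 pmulr_rle0 // invr_gt0 ltr0n.
apply/eqP; rewrite -normr_eq0 eq_le normr_ge0 andbT.
by have := F_le b Sb; rewrite s0 mulr0.
Qed.

Definition condition := {i : 'I_r & 'X_{1..3 < m i}}.
HB.instance Definition _ := Finite.on condition.

(** The Taylor coefficient of the monomial b at a point, as a polynomial in the coordinates of
    the i-th row of the configuration. *)
Definition condition_poly (k : condition) (b : box d) : {mpoly K[r * 3]} :=
  \prod_(c < 3) ('C(box_mnm b c, (tagged k : 'X_{1..3}) c)%:R *:
     'X_(mxvec_index (tag k) c) ^+ (box_mnm b c - (tagged k : 'X_{1..3}) c)).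

Lemma condition_poly_eval (k : condition) (b : box d) P :
  (condition_poly k b).@[fun j => mxvec P 0 j] =
  (translate (row (tag k) P) 'X_[box_mnm b])@_(tagged k).
Proof.
rewrite translate_coef rmorph_prod; apply: eq_bigr => c _ /=.
by rewrite mevalZ rmorphXn /= mevalXU mxvecE mxE.
Qed.

Lemma multihomogM (e1 e2 : 'I_r -> nat) (G1 G2 : {mpoly K[r * 3]}) :
  multihomog e1 G1 -> multihomog e2 G2 ->
  multihomog (fun i => e1 i + e2 i)%N (G1 * G2).
Proof.
move=> h1 h2 a /msuppM_le/allpairsP[[a1 a2] /= [a1G a2G ->]] i.
rewrite -(h1 _ a1G) -(h2 _ a2G) -big_split; apply: eq_bigr => c _.
by rewrite mnmDE.
Qed.

Lemma multihomog_sum (I : Type) (s : seq I) (e : 'I_r -> nat) (G : I -> {mpoly K[r * 3]}) :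
  (forall j, multihomog e (G j)) -> multihomog e (\sum_(j <- s) G j).
Proof.
move=> hG; elim: s => [|j s IHs]; first by rewrite big_nil => a; rewrite msupp0.
by rewrite big_cons => a /msuppD_le; rewrite mem_cat => /orP[/hG|/IHs].
Qed.

Lemma multihomogZ (e : 'I_r -> nat) x (G : {mpoly K[r * 3]}) :
  multihomog e G -> multihomog e (x *: G).
Proof. by move=> hG a /msuppZ_le; apply: hG. Qed.

Lemma multihomog_prod (I : Type) (s : seq I) (e : I -> 'I_r -> nat) (G : I -> {mpoly K[r * 3]}) :
  (forall j, multihomog (e j) (G j)) ->
  multihomog (fun i => \sum_(j <- s) e j i)%N (\prod_(j <- s) G j).
Proof.
move=> hG; elim: s => [|j s IHs].
  rewrite big_nil => a; rewrite msupp1 inE => /eqP-> i; rewrite big_nil.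
  by rewrite big1 // => c _; rewrite mnm0E.
rewrite big_cons => a aG i; rewrite big_cons.
exact: (multihomogM (hG j) IHs).
Qed.

Lemma mxvec_index_eq (i i' : 'I_r) (c c' : 'I_3) :
  (mxvec_index i c == mxvec_index i' c') = (i == i') && (c == c').
Proof.
have [f fK _] := curry_mxvec_bij r 3.
have inj_idx : injective (uncurry (@mxvec_index r 3)).
  by apply: (can_inj (g := f)) => x; apply: fK.
by rewrite -xpair_eqE -(inj_eq inj_idx).
Qed.

Definition condition_degree (k : condition) (i : 'I_r) : nat :=
  (tag k == i) * (d - mdeg (tagged k)).

Lemma multihomogXn i0 (c : 'I_3) n :
  multihomog (fun i => (i0 == i) * n)%N ('X_(mxvec_index i0 c) ^+ n : {mpoly K[r * 3]}).
Proof.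
move=> a; rewrite mpolyXn msuppX inE => /eqP-> i.
have [<-|ne_i] := eqVneq i0 i; rewrite ?mul1n ?mul0n.
  rewrite (bigD1 c) //= mulmnE mnm1E eqxx mul1n big1 ?addn0 // => c' ne_c.
  by rewrite mulmnE mnm1E mxvec_index_eq eqxx eq_sym (negPf ne_c) mul0n.
rewrite big1 // => c' _; rewrite mulmnE mnm1E mxvec_index_eq.
by rewrite (negPf ne_i) mul0n.
Qed.

(** When some exponent of the derivative exceeds that of the monomial, a binomial coefficient
    vanishes and the polynomial is 0; the truncated subtractions matter only in this case. *)
Lemma condition_poly_multihomog (k : condition) b :
  multihomog (condition_degree k) (condition_poly k b).
Proof.
case: k => i0 a; rewrite /condition_poly /condition_degree /=.
have [/forallP le_ab|] := boolP [forall c, (a : 'X_{1..3}) c <= box_mnm b c]%N; last first.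
  rewrite negb_forall => /existsP[c]; rewrite -ltnNge => lt_c a1.
  by rewrite (bigD1 c) //= bin_small // scale0r mul0r msupp0.
have -> : (d - mdeg a = \sum_(c < 3) (box_mnm b c - (a : 'X_{1..3}) c))%N.
  by rewrite -[X in (X - _)%N](mdeg_box b) !mdegE sumnB // => c _; apply: le_ab.
move=> a1 a1G i; rewrite big_distrr /=.
pose e c i := ((i0 == i) * (box_mnm b c - (a : 'X_{1..3}) c))%N.
apply: (multihomog_prod (e := e) _ a1G) => c.
by apply: multihomogZ; apply: multihomogXn.
Qed.

(** * Genericity *)

Definition form_on S (v : 'rV[K]_#|S|) : {mpoly K[3]} :=
  \sum_i v 0 i *: 'X_[box_mnm (enum_val i)].

Lemma form_on_homog S (v : 'rV[K]_#|S|) : form_on v \is d.-homog.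
Proof. by apply: rpred_sum => i _; rewrite rpredZ // dhomogX /= mdeg_box. Qed.

Lemma form_on_coef S (v : 'rV[K]_#|S|) i :
  (form_on v)@_(box_mnm (enum_val i)) = v 0 i.
Proof.
rewrite raddf_sum (bigD1 i) //= mcoeffZ mcoeffX eqxx mulr1 big1 ?addr0 // => j ne_ji.
rewrite mcoeffZ mcoeffX (inj_eq (@box_mnm_inj d)) (inj_eq enum_val_inj).
by rewrite (negPf ne_ji) mulr0.
Qed.

Lemma form_on_notin S (v : 'rV[K]_#|S|) b : b \notin S -> (form_on v)@_(box_mnm b) = 0.
Proof.
move=> S'b; rewrite raddf_sum big1 //= => i _; rewrite mcoeffZ mcoeffX.
case: eqP => [/box_mnm_inj eq_b|_]; last by rewrite mulr0.
by rewrite -eq_b enum_valP in S'b.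
Qed.

Lemma form_onE S (F : {mpoly K[3]}) : F \is d.-homog ->
  (forall b, b \notin S -> F@_(box_mnm b) = 0) ->
  F = form_on (\row_i F@_(box_mnm (@enum_val _ (mem S) i))).
Proof.
move=> hF F0; apply/mpolyP => a.
have [/box_of_mnm[b <-]|ne_d] := eqVneq (mdeg a) d; last first.
  by rewrite (dhomog_nemf_coeff hF ne_d) (dhomog_nemf_coeff (form_on_homog _) ne_d).
have [Sb|S'b] := boolP (b \in S); last by rewrite F0 ?form_on_notin.
by rewrite -(enum_rankK_in Sb Sb) form_on_coef mxE.
Qed.

Definition condition_mx S : 'M[{mpoly K[r * 3]}]_(#|S|, #|{: condition}|) :=
  \matrix_(i, j) condition_poly (enum_val j) (@enum_val _ (mem S) i).

Definition eval_at P : {mpoly K[r * 3]} -> K := meval (fun j => mxvec P 0 j).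
HB.instance Definition _ P := GRing.RMorphism.on (eval_at P).

Lemma condition_mxP S P (v : 'rV[K]_#|S|) : (forall i, row i P != 0) ->
  (forall i, mult_ge (m i) (row i P) (form_on v)) <->
  v *m map_mx (eval_at P) (condition_mx S) = 0.
Proof.
move=> P_neq0.
have vE (k : condition) : (v *m map_mx (eval_at P) (condition_mx S)) 0 (enum_rank k)
    = (translate (row (tag k) P) (form_on v))@_(tagged k).
  rewrite mxE /translate /form_on.
  rewrite (big_morph (comp_mpoly _) (comp_mpolyD _) (comp_mpoly0 _)) raddf_sum /=.
  apply: eq_bigr => i _; rewrite !mxE enum_rankK comp_mpolyZ mcoeffZ.
  by congr (_ * _); apply: condition_poly_eval.
split=> [mF|v0 i].
  apply/rowP => j; rewrite -[j]enum_valK vE mxE.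
  have /(mult_ge_translate _ (P_neq0 _) (form_on_homog v)) vF := mF (tag (enum_val j)).
  by apply/vF/bmdeg.
apply/(mult_ge_translate _ (P_neq0 _) (form_on_homog v)) => a lt_a.
have := vE (Tagged (fun i => 'X_{1..3 < m i}) (BMultinom lt_a)).
by rewrite v0 mxE.
Qed.

(** Transversality of the linear system to the coordinate subspace of the forms supported on S. *)
Definition no_form_on S P := forall F : dhomog 3 K d,
  (forall i, mult_ge (m i) (row i P) F) ->
  (forall b, b \notin S -> F@_(box_mnm b) = 0) -> F = 0.

Lemma no_form_on_row_free S P : (forall i, row i P != 0) -> no_form_on S P ->
  row_free (map_mx (eval_at P) (condition_mx S)).
Proof.
move=> P_neq0 PS; rewrite -kermx_eq0; apply/rowV0P => v /sub_kermxP.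
move/(condition_mxP v P_neq0) => mv.
have := PS (DHomog (form_on_homog v)) mv (@form_on_notin _ v).
move/(congr1 (@mpoly_of_dhomog _ _ _)) => /= v0.
by apply/rowP => i; rewrite -form_on_coef v0 mcoeff0 mxE.
Qed.

(** At P0 the rows of the matrix of conditions indexed by S are independent, so some maximal
    minor does not vanish. Its multidegree depends only on the conditions that are selected,
    since each entry has the multidegree of its condition. *)
Lemma generic_no_form_on S P0 : (forall i, row i P0 != 0) -> no_form_on S P0 ->
  for_general_points (no_form_on S).
Proof.
move=> P0_neq0 P0S; have := no_form_on_row_free P0_neq0 P0S.
set M0 := map_mx _ _ => freeM.
have fullM : row_full M0^T by rewrite /row_full mxrank_tr.
pose f := fullrankfun fullM.
pose B : 'M[{mpoly K[r * 3]}]_#|S| := rowsub f (condition_mx S)^T.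
have evalB P : eval_at P (\det B) = \det (rowsub f (map_mx (eval_at P) (condition_mx S))^T).
  by rewrite -det_map_mx; congr (\det _); apply/matrixP => i j; rewrite !mxE.
exists (fun i => \sum_(j < #|S|) condition_degree (enum_val (f j)) i)%N, (\det B).
split.
- apply: multihomog_sum => s; rewrite -signr_odd.
  have -> x : (-1) ^+ odd (perm.odd_perm s) * x =
      ((-1) ^+ odd (perm.odd_perm s) : K) *: x :> {mpoly K[r * 3]}.
    by rewrite -mul_mpolyC rmorphXn rmorphN rmorph1.
  apply/multihomogZ/multihomog_prod => j; rewrite !mxE.
  exact: condition_poly_multihomog.
- have : eval_at P0 (\det B) != 0.
    by rewrite evalB -unitfE -[_ \is a _]/(_ \in unitmx) fullrowsub_unit.
  by apply: contraNneq => ->; rewrite rmorph0.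
move=> P P_neq0 detP F mF F0; apply: val_inj => /=.
rewrite (form_onE (dhomog_is_dhomog F) F0) in mF *; set v := \row__ _ in mF *.
suff -> : v = 0 by rewrite /form_on big1 // => i _; rewrite mxE scale0r.
have vM := proj1 (condition_mxP v P_neq0) mF.
have uB : rowsub f (map_mx (eval_at P) (condition_mx S))^T \in unitmx.
  by rewrite unitmxE unitfE -evalB.
apply: trmx_inj; rewrite trmx0 -(mulKmx uB v^T) mul_rowsub_mx.
rewrite -trmx_mul vM trmx0 (_ : rowsub f 0 = 0) ?mulmx0 //.
by apply/matrixP => i j; rewrite !mxE.
Qed.

End Generic.

(** * Dimension counts *)

Lemma codim_bigcap (K : fieldType) (V : vectType K) (I : finType) (W : I -> {vspace V})
    (e : I -> nat) : (forall i, \dim {:V} <= \dim (W i) + e i)%N ->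
  (\dim {:V} <= \dim (\bigcap_i W i)%VS + \sum_i e i)%N.
Proof.
move=> We; elim/big_rec2: _ => [|i n X _ IH]; first by rewrite addn0.
have := dimv_sum_cap (W i) X; have := dimvS (subvf (W i + X)%VS).
by have := We i; lia.
Qed.

Section Dimension.
Variables (K : numFieldType) (d r : nat) (m : 'I_r -> nat).
Implicit Types (P : 'M[K]_(r, 3)) (U : {set 'I_r}) (S : {set box d}).

Definition coords_outside S (F : dhomog 3 K d) : 'rV[K]_#|~: S| :=
  \row_j F@_(box_mnm (@enum_val _ (mem (~: S)) j)).

Fact coords_outside_linear S : linear (coords_outside S).
Proof. by move=> x F G; apply/rowP => j; rewrite !mxE /= mcoeffD mcoeffZ. Qed.

HB.instance Definition _ S := GRing.isLinear.Build K (dhomog 3 K d) 'rV[K]_#|~: S| _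
  (coords_outside S) (coords_outside_linear S).

(** The map sending a form to its coefficients outside S is injective on the system. *)
Lemma no_form_on_dim S P : no_form_on m S P ->
  (\dim (linear_system d m P) <= #|~: S|)%N.
Proof.
move=> PS; rewrite -(limg_ker_dim (linfun (coords_outside S))).
have -> : (linear_system d m P :&: lker (linfun (coords_outside S)))%VS = 0%VS.
  apply/eqP; rewrite -subv0; apply/subvP => F; rewrite memv_cap memv_ker lfunE memv0.
  case/andP => /linear_systemP mF /eqP F0; apply/eqP/PS => // b; rewrite -in_setC => Sb.
  have /rowP/(_ (enum_rank_in Sb b)) := F0.
  by rewrite !mxE enum_rankK_in.
rewrite dimv0 add0n; apply: leq_trans (dimvS (subvf _)) _.
by rewrite dimvf /dim /= mul1n.
Qed.

Lemma dim_lker_form (V : vectType K) (f : 'Hom(V, K^o)) :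
  (\dim {:V} <= \dim (lker f) + 1)%N.
Proof.
have := limg_ker_dim f {:V}; rewrite capfv => <-.
by rewrite leq_add2l (leq_trans (dimvS (subvf _))) // dimvf /dim /=.
Qed.

(** Each Taylor coefficient of the local equation is one linear condition, void when its
    monomial involves the coordinate of the chart. *)
Lemma dim_linear_system_ge P : (forall i, (0 < m i)%N) ->
  ('C(d + 2, 2) <= \dim (linear_system d m P) + \sum_i 'C(m i + 1, 2))%N.
Proof.
move=> m_gt0.
have -> : 'C(d + 2, 2) = \dim {:dhomog 3 K d}.
  by rewrite dimvf /dim /= -(@bin_sub _ 2) ?leq_addl // addnK.
apply: codim_bigcap => i.
pose k := chart (row i P).
pose e (a : 'X_{1..3 < m i}) : nat := (a : 'X_{1..3}) k == 0%N.
pose W (a : 'X_{1..3 < m i}) := lker (linfun (@local_coef K d (row i P) a)).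
apply: leq_trans (@codim_bigcap K _ _ W e _) _ => [a|].
  rewrite /e; have [ak0|ak_neq0] := eqVneq ((a : 'X_{1..3}) k) 0%N.
    exact: dim_lker_form.
  rewrite addn0 dimvS //; apply/subvP => F _; rewrite memv_ker lfunE /=.
  by rewrite /local_coef local_eq_dehom dehom_coef0.
rewrite leq_add2l; apply: leq_trans (card_local_conditions k (m_gt0 i)).
by rewrite -sum1_card [leqRHS]big_mkcond leq_sum.
Qed.

Lemma reachable_generic_dim U S : reachable m U S ->
  for_general_points (fun P => \dim (linear_system d m P) <= #|~: S|)%N.
Proof.
move=> /reachable_approximable-/(_ K)/approximable_no_form[P0 [P0_neq0 P0S]].
have [||e [G [hG G_neq0 GP]]] := @generic_no_form_on K d r m S P0 => //.
  move=> F mF F0; apply/val_inj => /=; rewrite (box_expansion (dhomog_is_dhomog F)).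
  by rewrite big1 // => b _; rewrite (P0S F mF F0) scale0r.
by exists e, G; split=> // P P_neq0 /(GP P P_neq0)/no_form_on_dim.
Qed.

Lemma reachable_card U S : (forall i, (0 < m i)%N) -> reachable m U S ->
  (\sum_(i in U) 'C(m i + 1, 2) <= #|S|)%N.
Proof.
move=> m_gt0; elim=> [|{}U {}S i c _ IH U'i le_m disj|{}U {}S c t _ IH ne_tc].
- by rewrite big_set0.
- rewrite big_setU1 //= cardsU (disjoint_setI0 disj) cards0 subn0.
  by rewrite leq_add // card_corner_triangle.
by rewrite card_slide.
Qed.

End Dimension.

Theorem mainTheorem3 (R : realType) (d r : nat) (m : 'I_r -> nat)
    (m_gt0 : forall i, (0 < m i)%N) :
  (forall (U : {set 'I_r}) (S : {set box d}), reachable m U S ->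
     @for_general_points (complex R) r
       (fun P => proj_dim (linear_system d m P) <= #|~: S|%:Z - 1))
  /\
  ((exists S : {set box d}, reachable m [set: 'I_r] S) ->
     non_special (complex R) d m).
Proof.
split=> [U S /(reachable_generic_dim (complex R))|[S reachS]].
  case=> e [G [hG G_neq0 GP]]; exists e, G; split=> // P P_neq0 /(GP P P_neq0) le_dim.
  by rewrite /proj_dim lerB // lez_nat.
have [e [G [hG G_neq0 GP]]] := reachable_generic_dim (complex R) reachS.
exists e, G; split=> // P P_neq0 /(GP P P_neq0) le_dim.
have ge_dim := dim_linear_system_ge d P m_gt0.
have := reachable_card m_gt0 reachS.
rewrite (eq_bigl xpredT) => [le_S|i]; last by rewrite inE.
have := cardsC S; rewrite card_box /proj_dim /expected_dim => cardS.
rewrite -(big_morph Posz PoszD (erefl _)).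
move: le_dim ge_dim le_S cardS; move: (\dim _) (\sum_i _)%N #|S| #|~: S| => D N s s'.
lia.
Qed.
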